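(* Let $\mathbf{x}\in\mathbf{X}$ be the unique solution of $$(\tilde P)\quad 0\in\partial[\operatorname{cl}(\mathbf{f}\Box\iota_\Delta)](\mathbf{x})+(\operatorname{Id}-\mathbf{R})\mathbf{x}\ \text{ and }\ \mathbf{x}\in\Delta^\perp,$$ and let $\mathbf{y}\in\mathbf{X}$ be the unique solution of $$(\tilde D)\quad 0\in\partial(\mathbf{f}^*+\iota_\Delta^* )(\mathbf{y})+\tfrac12\mathbf{y}+T\mathbf{y}.$$ Then: (i) $\mathbf{x},\mathbf{y}\in\Delta^\perp$. (ii) $\mathbf{y}=\mathbf{R}\mathbf{x}-\mathbf{x}$. (iii) $\mathbf{x}=-\frac{\mathbf{y}}{2}-T\mathbf{y}$. (iv) $\mathbf{Z}=(\mathbf{x}+\Delta)\cap(\partial\mathbf{f})^{-1}(\mathbf{R}\mathbf{x}-\mathbf{x})=(\operatorname{Id}-\mathbf{R})^{-1}(-\mathbf{y})\cap(\partial\mathbf{f})^{-1}(\mathbf{y})$. (v) $\mathbf{Z}\subseteq(F_1\times\cdots\times F_m)\cap(\operatorname{Id}-\mathbf{R})^{-1}(-\mathbf{y})$.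
   Context: $X$ is a real Hilbert space, $m\in\{1,2,\dots\}$, $\mathbf{X}=X^m$ is the product Hilbert space, $\mathbf{R}(x_1,\dots,x_m)=(x_m,x_1,\dots,x_{m-1})$, $\Delta=\{(x,\dots,x):x\in X\}$ with orthogonal complement $\Delta^\perp$, $(\operatorname{Id}-\mathbf{R})^{-1}$ is the set-valued inverse, and $T=\frac{1}{2m}\sum_{k=1}^{m-1}(m-2k)\mathbf{R}^k$. $f_1,\dots,f_m$ are proper lower semicontinuous convex functions $X\to\,]-\infty,+\infty]$, $\mathbf{f}(x_1,\dots,x_m)=\sum_{i=1}^m f_i(x_i)$, $\mathbf{f}^*$ is the Fenchel conjugate, $\iota_\Delta$ the indicator function of $\Delta$ (so $\iota_\Delta^*=\iota_{\Delta^\perp}$), $(\mathbf{f}\Box\iota_\Delta)(\mathbf{x})=\inf_{\mathbf{u}\in\mathbf{X}}(\mathbf{f}(\mathbf{u})+\iota_\Delta(\mathbf{x}-\mathbf{u}))$, $\operatorname{cl}$ is the lower semicontinuous hull, and $\partial$ the convex subdifferential. Standing assumption: $\operatorname{dom}\mathbf{f}^*\cap\Delta^\perp\neq\varnothing$; under it, $(\tilde P)$ and $(\tilde D)$ each have exactly one solution. $\mathbf{Z}=\{\mathbf{z}\in\mathbf{X}:0\in\partial\mathbf{f}(\mathbf{z})+\mathbf{z}-\mathbf{R}\mathbf{z}\}$ is the set of classical cycles of $\mathbf{f}$. With $\operatorname{Prox}_{f_i}=(\operatorname{Id}+\partial f_i)^{-1}$, $F_i:=\operatorname{Fix}\big(\operatorname{Prox}_{f_i}\cdots\operatorname{Prox}_{f_1}\operatorname{Prox}_{f_m}\cdots\operatorname{Prox}_{f_{i+1}}\big)$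 for $1\le i\le m$ (for $i=m$ the composition is $\operatorname{Prox}_{f_m}\cdots\operatorname{Prox}_{f_1}$). *)

(* Defs.v *)
From HB Require Import structures.
From mathcomp Require Import all_boot all_order all_algebra.
From mathcomp Require Import sesquilinear.
From mathcomp Require Import ring lra.
From mathcomp Require Import all_classical all_reals all_analysis.

Set Implicit Arguments.
Unset Strict Implicit.
Unset Printing Implicit Defensive.
Import Order.TTheory GRing.Theory Num.Theory.
Import numFieldNormedType.Exports.

Local Open Scope classical_set_scope.
Local Open Scope ring_scope.

HB.mixin Record NormedModule_hasDot (R : realType) X & NormedModule R X := {
  inner : {dot X for idfun};
  innerE : forall x : X, inner x x = `|x| ^+ 2
}.

#[short(type="hilbertType")]
HB.structure Definition Hilbert (R : realType) :=
  {X of CompleteNormedModule R X & NormedModule_hasDot R X}.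


Section dot_norm.
Context {R : realType} {V : lmodType R} (d : {dot V for idfun}).

Definition dot_norm (x : V) : R := Num.sqrt (d x x).

Let dC x y : d x y = d y x. Proof. by rewrite hermC expr0 mul1r. Qed.

Let d_ge0 x : 0 <= d x x.
Proof.
have [->|x0] := eqVneq x 0; first by rewrite linear0l.
exact/ltW/neq0_dnorm_gt0.
Qed.

Lemma dot_norm_eq0 x : dot_norm x = 0 -> x = 0.
Proof.
move=> /eqP; rewrite sqrtr_eq0 => dx; apply/eqP; apply: contraT => x0.
by have := neq0_dnorm_gt0 (s := d) x x0; rewrite ltNge dx.
Qed.

Lemma dot_normZ a x : dot_norm (a *: x) = `|a| * dot_norm x.
Proof.
by rewrite /dot_norm linearZl linearZr /= mulrA -expr2 sqrtrM ?sqr_ge0// sqrtr_sqr.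
Qed.

Lemma sqr_dot_norm x : dot_norm x ^+ 2 = d x x.
Proof. by rewrite sqr_sqrtr. Qed.

Lemma dot_CauchySchwarz x y : d x y <= dot_norm x * dot_norm y.
Proof.
have [->|y0] := eqVneq y 0.
  by rewrite linear0r mulr_ge0 // sqrtr_ge0.
have dy := neq0_dnorm_gt0 (s := d) y y0.
suff h : d x y ^+ 2 <= d x x * d y y.
  rewrite -sqrtrM// (le_trans (ler_norm _))// -sqrtr_sqr.
  by rewrite ler_sqrt// mulr_ge0.
have := d_ge0 (d y y *: x - d x y *: y).
rewrite linearBl !linearBr !linearZl !linearZr /= (dC y x) => h.
have : 0 <= d y y * (d x x * d y y - d x y ^+ 2) by nra.
by rewrite pmulr_rge0// subr_ge0.
Qed.

Lemma dot_normD x y : dot_norm (x + y) <= dot_norm x + dot_norm y.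
Proof.
rewrite -ler_sqr ?nnegrE ?addr_ge0 ?sqrtr_ge0//.
rewrite sqr_dot_norm sqrrD !sqr_dot_norm linearDl !linearDr /= (dC y x).
have := dot_CauchySchwarz x y; lra.
Qed.

End dot_norm.

(* Finite products of Hilbert spaces: the norm and topology on {ffun I -> X} are
   those of the inner product \sum_i inner (x i) (y i). *)
Section product.
Context {R : realType} {I : finType} {X : hilbertType R}.
Implicit Types x y : {ffun I -> X}.

Definition ffun_dot x y : R := \sum_i inner (x i) (y i).

Let ffun_dot_linearl y : linear_for *%R (ffun_dot^~ y).
Proof.
move=> a u v; rewrite /ffun_dot mulr_sumr -big_split /=.
by apply: eq_bigr => i _; rewrite !ffunE linearPl.
Qed.

Let ffun_dot_linearr x : linear_for (idfun \; *%R) (ffun_dot x).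
Proof.
move=> a u v; rewrite /ffun_dot /= mulr_sumr -big_split /=.
by apply: eq_bigr => i _; rewrite !ffunE linearPr.
Qed.

HB.instance Definition _ := bilinear_isBilinear.Build R
  {ffun I -> X} {ffun I -> X} R *%R (idfun \; *%R) ffun_dot
  (ffun_dot_linearl, ffun_dot_linearr).

Let ffun_dotC x y : ffun_dot x y = (-1) ^+ false * idfun (ffun_dot y x).
Proof.
rewrite expr0 mul1r /=; apply: eq_bigr => i _.
by rewrite hermC expr0 mul1r.
Qed.

HB.instance Definition _ := isHermitianSesquilinear.Build R {ffun I -> X}
  false idfun ffun_dot ffun_dotC.

Let ffun_dot_gt0 x : x != 0 -> 0 < ffun_dot x x.
Proof.
have ge0 i : 0 <= inner (x i) (x i) by rewrite innerE sqr_ge0.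
move=> x0; rewrite lt_neqAle sumr_ge0// andbT eq_sym.
apply: contraNneq x0 => /eqP; rewrite psumr_eq0// => /allP x0.
apply/eqP/ffunP => i; rewrite ffunE; apply/eqP.
by have := x0 i (mem_index_enum i); rewrite /= innerE sqrf_eq0 normr_eq0.
Qed.

HB.instance Definition _ := isDotProduct.Build R {ffun I -> X}
  ffun_dot ffun_dot_gt0.

HB.instance Definition _ := Lmodule_isNormed.Build R {ffun I -> X}
  (dot_normD ffun_dot) (dot_normZ ffun_dot) (@dot_norm_eq0 _ _ ffun_dot).

Let ffun_innerE x : ffun_dot x x = `|x| ^+ 2.
Proof. by rewrite -sqr_dot_norm. Qed.

Let ffun_norm_ge x i : `|x i| <= `|x|.
Proof.
rewrite -ler_sqr ?nnegrE// -ffun_innerE -innerE /ffun_dot (bigD1 i)//= lerDl.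
by apply: sumr_ge0 => j _; rewrite innerE sqr_ge0.
Qed.

Let ffun_norm_le x : `|x| <= \sum_i `|x i|.
Proof.
rewrite -ler_sqr ?nnegrE ?sumr_ge0// -ffun_innerE /ffun_dot.
under eq_bigr do rewrite innerE.
rewrite expr2 mulr_suml; apply: ler_sum => i _; rewrite expr2.
by apply: ler_wpM2l => //; rewrite (bigD1 i)//= lerDl sumr_ge0.
Qed.

Let ffun_complete (F : set_system {ffun I -> X}) :
  ProperFilter F -> cauchy F -> cvg F.
Proof.
move=> FF /cauchy_ballP Fc.
have cvgi i : cvg ((fun x : {ffun I -> X} => x i) @ F).
  apply: cauchy_cvg; apply/cauchy_ballP => e e0.
  have [[A B] [/= FA FB] AB] := Fc e e0.
  exists ((fun x : {ffun I -> X} => x i) @` A, (fun x : {ffun I -> X} => x i) @` B).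
    by split; [apply: filterS FA | apply: filterS FB] => x Ax /=; exists x.
  move=> [_ _] /= [[x Ax <-] [y By <-]]; have := AB (x, y) (conj Ax By).
  rewrite -!ball_normE /= => xy; apply: le_lt_trans xy.
  by have := ffun_norm_ge (x - y) i; rewrite !ffunE.
apply/cvg_ex; exists [ffun i => lim ((fun x : {ffun I -> X} => x i) @ F)].
apply/cvgrPdist_lt => e e0.
have e'0 : 0 < e / #|I|.+1%:R by rewrite divr_gt0.
have : F [set x : {ffun I -> X} | forall i,
    `|lim ((fun x : {ffun I -> X} => x i) @ F) - x i| < e / #|I|.+1%:R].
  by apply: filter_forall => i; move/cvgrPdist_lt : (cvgi i); apply.
apply: filterS => x h; apply: le_lt_trans (ffun_norm_le _) _.
apply: (@le_lt_trans _ _ (\sum_(i : I) e / #|I|.+1%:R)).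
  by apply: ler_sum => i _; rewrite !ffunE ltW.
rewrite sumr_const -[_ *+ #|_|]mulr_natr mulrAC ltr_pdivrMr// ltr_pM2l//.
by rewrite ltr_nat.
Qed.

HB.instance Definition _ :=
  Uniform_isComplete.Build {ffun I -> X} ffun_complete.

HB.instance Definition _ := NormedModule_hasDot.Build R {ffun I -> X} ffun_innerE.

End product.

Section convex_analysis.
Context {R : realType} {H : hilbertType R}.
Implicit Types (f g : H -> \bar R) (C : set H) (A B : H -> set H).

Definition dom f : set H := [set x | (f x < +oo)%E].

Definition proper_fun f : Prop := (forall x, f x != -oo%E) /\ dom f !=set0.

(* The library's convex_function only covers real-valued functions. The strict
   bounds on t keep the products with infinite values away from 0 * oo. *)
Definition convex_fun f : Prop := forall (x y : H) (t : R), 0 < t < 1 ->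
  (f (t *: x + (1 - t) *: y)%R <= t%:E * f x + (1 - t)%:E * f y)%E.

Definition indicator C : H -> \bar R :=
  fun x => if x \in C then 0%E else +oo%E.

Definition conjugate f : H -> \bar R :=
  fun u => ereal_sup (range (fun x => (inner x u)%:E - f x)%E).

Definition inf_convolution f g : H -> \bar R :=
  fun x => ereal_inf (range (fun u => f u + g (x - u)%R)%E).

(* Largest lower semicontinuous minorant. *)
Definition lsc_hull f : H -> \bar R := fun x =>
  ereal_sup [set h x | h in
    [set h | lower_semicontinuous h /\ forall z, (h z <= f z)%E]].

(* In the textbook way, without requiring f x to be finite: for proper f the
   subdifferential is automatically empty outside of dom f. *)
Definition subdiff f : H -> set H := fun x =>
  [set u | forall y, ((inner (y - x)%R u)%:E + f x <= f y)%E].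

Definition orth C : set H := [set y | forall x, C x -> inner x y = 0].

(* Set-valued operators on H are functions H -> set H; inv_op is the set-valued
   inverse and comp_op A B is A after B. *)
Definition inv_op A : H -> set H := fun u => [set x | A x u].

Definition comp_op A B : H -> set H := fun x => \bigcup_(y in B x) A y.

Definition Fix A : set H := [set x | A x x].

(* (Id + subdiff f)^-1 as a set-valued operator; it is single-valued for f
   proper, lower semicontinuous and convex. *)
Definition Prox f : H -> set H :=
  inv_op (fun x => [set x + u | u in subdiff f x]).

End convex_analysis.

(* The product Hilbert space X^m is {ffun 'I_m -> X}: coordinates are numbered
   from 0 to m - 1 instead of 1 to m. *)
Section product_space.
Context {R : realType} {X : hilbertType R} {m : nat}.
Implicit Types (x y : {ffun 'I_m -> X}) (f : 'I_m -> X -> \bar R).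

(* ord_pred is the cyclic predecessor, so this is
   (x_1, ..., x_m) |-> (x_m, x_1, ..., x_{m-1}). *)
Definition cycR x : {ffun 'I_m -> X} := [ffun i => x (ord_pred i)].

Definition Delta : set {ffun 'I_m -> X} := range (fun a : X => [ffun=> a]).

Definition opT x : {ffun 'I_m -> X} :=
  (2 * m%:R : R)^-1 *:
    \sum_(1 <= k < m) (m%:R - 2 * k%:R : R) *: iter k cycR x.

Definition IdR : {ffun 'I_m -> X} -> set {ffun 'I_m -> X} :=
  fun x => [set x - cycR x].

Definition sep_sum f : {ffun 'I_m -> X} -> \bar R :=
  fun x => (\sum_(i < m) f i (x i))%E.

Definition primal_sol f x : Prop :=
  [set u + (x - cycR x) |
    u in subdiff (lsc_hull (inf_convolution (sep_sum f) (indicator Delta))) x] 0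
  /\ orth Delta x.

Definition dual_sol f y : Prop :=
  [set u + 2^-1 *: y + opT y |
    u in subdiff (fun v => conjugate (sep_sum f) v
                           + conjugate (indicator Delta) v)%E y] 0.

Definition cycles f : set {ffun 'I_m -> X} :=
  [set z | [set u + z - cycR z | u in subdiff (sep_sum f) z] 0].

(* With coordinates numbered from 0, rot i.+1 (enum 'I_m) lists
   i + 1, ..., m - 1, 0, ..., i, the order in which the operators are applied. *)
Definition prox_cycle f (i : 'I_m) : X -> set X :=
  foldl (fun A j => comp_op (Prox (f j)) A) (fun a => [set a])
    (rot i.+1 (enum 'I_m)).

End product_space.

(* Main.v *)
Require Import Defs.
From HB Require Import structures.
From mathcomp Require Import all_boot all_order all_algebra.
From mathcomp Require Import sesquilinear.
From mathcomp Require Import ring lra.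
From mathcomp Require Import all_classical all_reals all_analysis.
Import Order.TTheory GRing.Theory Num.Theory.
Import numFieldNormedType.Exports.
Local Open Scope classical_set_scope.
Local Open Scope ring_scope.

(** Everything rests on the uniqueness of the dual solution. The operator
    Id / 2 + T is strongly monotone, T being skew ([inner_opT]), while
    subdifferentials are monotone; hence the dual inclusion has at most one
    solution ([dual_sol_unique]). It therefore suffices to produce dual
    solutions of the form R x - x and to compare them with y.

    Two facts do this. First, Id / 2 + T inverts Id - R on the orthogonal
    complement of the diagonal ([half_opT_subr_cycR]); hence, for x orthogonal
    to the diagonal, R x - x solves the dual inclusion as soon as x is a
    subgradient, at R x - x, of the function f^* + iota^* of the dual problem
    ([dual_sol_of_subdiff]). Second, that function is the conjugate of
    cl (f box iota) ([conjugate_inf_convolution], [conjugate_lsc_hull]).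

    If x solves the primal inclusion, R x - x is a subgradient of
    cl (f box iota) at x, so by Fenchel-Young x is a subgradient of the
    conjugate at R x - x. This gives y = R x - x ([primal_sol_dual_sol]), and
    the formula for x is then the inversion of Id - R.

    If z is a classical cycle, R z - z is a subgradient of f at z, and the same
    argument applied to the projection of z onto the orthogonal complement
    of the diagonal shows that R z - z is a dual solution
    ([cycles_dual_sol]). So all cycles share the gap vector y. Two vectors
    have the same gap exactly when they differ by a diagonal vector, the
    diagonal being the fixed-point set of R; this gives both descriptions of
    the set of cycles. Finally, a subgradient of a separable sum splits into
    coordinates ([subdiff_sep_sum]), so that each coordinate of a cycle is
    the image of the preceding one by a proximity operator, and going once
    around returns to the starting coordinate. *)

(** * Inner products and affine functions *)

Section inner_product.
Context {R : realType} {H : hilbertType R}.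
Implicit Types x y u : H.

Lemma innerC x y : inner x y = inner y x.
Proof. by rewrite hermC expr0 mul1r. Qed.

Lemma innerBl x y z : inner (x - y) z = inner x z - inner y z.
Proof. exact: linearBl. Qed.

Lemma innerDr x y z : inner x (y + z) = inner x y + inner x z.
Proof. exact: linearDr. Qed.

Lemma innerBr x y z : inner x (y - z) = inner x y - inner x z.
Proof. exact: linearBr. Qed.

Lemma innerZr x (a : R) y : inner x (a *: y) = a * inner x y.
Proof. exact: linearZr. Qed.

Lemma inner_sumr x (I : Type) (r : seq I) (P : pred I) (F : I -> H) :
  inner x (\sum_(i <- r | P i) F i) = \sum_(i <- r | P i) inner x (F i).
Proof. exact: linear_sumr. Qed.

Lemma inner_eq0 x : inner x x = 0 -> x = 0.
Proof. by rewrite innerE => /eqP; rewrite sqrf_eq0 normr_eq0 => /eqP. Qed.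

Lemma dot_norm_inner x : dot_norm inner x = `|x|.
Proof. by rewrite /dot_norm innerE sqrtr_sqr normr_id. Qed.

Lemma lower_semicontinuous_affine u (c : R) :
  lower_semicontinuous (fun x => (inner x u - c)%:E).
Proof.
move=> x a; rewrite lte_fin => ax.
have u0 : 0 < `|u| + 1 by rewrite ltr_wpDl.
exists (ball x ((inner x u - c - a) / (`|u| + 1))).
  by apply: nbhsx_ballx; rewrite divr_gt0// subr_gt0.
move=> y; rewrite -ball_normE /= ltr_pdivlMr// lte_fin => xy.
have := dot_CauchySchwarz inner (x - y) u.
rewrite !dot_norm_inner linearBl => h.
have := normr_ge0 (x - y); lra.
Qed.

End inner_product.

(** * Fenchel conjugation through affine minorants *)

Section conjugation.
Context {R : realType} {H : hilbertType R}.
Implicit Types (f g : H -> \bar R) (x u : H).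

(** The conjugate at u is the least shift c that makes the affine function
    x |-> <x, u> - c a minorant of f. In this form the conjugates of infima and
    of lower semicontinuous hulls are found by comparing sets of affine
    minorants, without case analysis on infinite values. *)
Lemma conjugate_leP f u (c : R) :
  (conjugate f u <= c%:E)%E <-> forall x, ((inner x u - c)%:E <= f x)%E.
Proof.
have E x : ((inner x u)%:E - f x <= c%:E)%E = ((inner x u - c)%:E <= f x)%E.
  case: (f x) => [r| |] //=; last by rewrite leNgt ltNge leNye leey.
  by rewrite -EFinB !lee_fin lerBlDr lerBlDl.
split=> [h x|h].
  rewrite -E; apply: le_trans h; apply: ereal_sup_ubound; by exists x.
by apply: ge_ereal_sup => _ [x _ <-]; rewrite E.
Qed.

Lemma conjugate_gtNy f u : dom f !=set0 -> conjugate f u != -oo%E.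
Proof.
case=> x fx; apply/eqP => E.
have h (c : R) : ((inner x u - c)%:E <= f x)%E.
  by apply: (conjugate_leP f u c).1; rewrite E leNye.
move: fx h; rewrite /dom /=; case: (f x) => [r| |] // _ h.
  by have := h (inner x u - r - 1); rewrite lee_fin; lra.
by have := h 0; rewrite leeNy_eq.
Qed.

(** A conjugate value other than +oo yields an affine minorant. *)
Lemma gtNy_of_conjugate f x : dom (conjugate f) !=set0 -> f x != -oo%E.
Proof.
case=> u; rewrite /dom /=; case E : (conjugate f u) => [c| |] // _.
  have /conjugate_leP/(_ x) : (conjugate f u <= c%:E)%E by rewrite E.
  by case: (f x).
have /conjugate_leP/(_ x) : (conjugate f u <= 0%:E)%E by rewrite E leNye.
by case: (f x).
Qed.

Lemma le_EFin_ub (a b : \bar R) :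
  (forall c : R, (b <= c%:E)%E -> (a <= c%:E)%E) -> (a <= b)%E.
Proof.
case: b => [b| |] h; [exact: h|exact: leey|].
case: a h => [a| |] h //; last by have := h 0 (leNye _).
have := h (a - 1) (leNye _); rewrite lee_fin => ha; exfalso; lra.
Qed.

(** Affine functions are lower semicontinuous, so f and its hull have the same
    affine minorants. *)
Lemma conjugate_lsc_hull f : conjugate (lsc_hull f) = conjugate f.
Proof.
apply/funext => u; apply/eqP; rewrite eq_le; apply/andP; split;
    apply: le_EFin_ub => c /conjugate_leP h; apply/conjugate_leP => x.
  apply: ereal_sup_ubound; exists (fun x => (inner x u - c)%:E) => //.
  by split => //; exact: lower_semicontinuous_affine.
by apply: (le_trans (h x)); apply: ge_ereal_sup => _ [k [_ kf] <-].
Qed.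

(** The affine functions of slope u below f box g are the sums of an affine
    function of slope u below f and one below g: minimizing over v + w = x
    decouples the two variables. *)
Lemma conjugate_inf_convolution f g : proper_fun f -> proper_fun g ->
  conjugate (inf_convolution f g) = (fun u => conjugate f u + conjugate g u)%E.
Proof.
move=> [fNy fdom] [gNy gdom]; apply/funext => u.
have infP (c : R) : (conjugate (inf_convolution f g) u <= c%:E)%E <->
    forall v w, ((inner v u + inner w u - c)%:E <= f v + g w)%E.
  split=> [/conjugate_leP h v w|h].
    rewrite -linearDl; apply: le_trans (h _) _.
    by apply: ereal_inf_lbound; exists v => //; rewrite (addrC v) addrK.
  apply/conjugate_leP => x; apply: le_ereal_inf_tmp => _ [v _ <-].
  rewrite (_ : inner x u = inner v u + inner (x - v) u)//.
  by rewrite innerBl addrC subrK.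
have cf := conjugate_gtNy f u fdom; have cg := conjugate_gtNy g u gdom.
apply/eqP; rewrite eq_le; apply/andP; split; apply: le_EFin_ub => c.
  case Ef : (conjugate f u) cf => [a| |] // _;
    case Eg : (conjugate g u) cg => [b| |] // _.
  rewrite -EFinD lee_fin => abc; apply/infP => v w.
  have /conjugate_leP/(_ v) hv : (conjugate f u <= a%:E)%E by rewrite Ef.
  have /conjugate_leP/(_ w) hw : (conjugate g u <= b%:E)%E by rewrite Eg.
  by apply: le_trans (leeD hv hw); rewrite -EFinD lee_fin; lra.
move/infP => h.
(* One point of dom g bounds the conjugate of f, which is then a real number
   that can be moved to the other side. *)
case: (gdom) => w0 /=; rewrite /dom /=.
have := gNy w0; case Eg : (g w0) => [b| |] // _ _.
have : (conjugate f u <= (c + b - inner w0 u)%:E)%E.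
  apply/conjugate_leP => v; have := h v w0; rewrite Eg.
  rewrite -leeBlDr// -EFinB => h'; apply: le_trans h'; rewrite lee_fin; lra.
case Ef : (conjugate f u) cf => [a| |] // _ _.
rewrite -leeBrDl //; apply/conjugate_leP => w.
have := gNy w; case Ew : (g w) => [d| |] // _; last exact: leey.
have : (conjugate f u <= (c + d - inner w u)%:E)%E.
  apply/conjugate_leP => v; have := h v w; rewrite Ew.
  rewrite -leeBlDr// -EFinB => h'; apply: le_trans h'; rewrite lee_fin; lra.
rewrite Ef !lee_fin; lra.
Qed.

Lemma lsc_hull_le f x : (lsc_hull f x <= f x)%E.
Proof. by apply: ge_ereal_sup => _ [k [_ kf] <-]. Qed.

End conjugation.

(** * Subgradients *)

Section subdifferential.
Context {R : realType} {H : hilbertType R}.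
Implicit Types (f g : H -> \bar R) (x u : H).

(** The subgradient inequality at a point where the proper function f is finite
    excludes the value +oo at x. *)
Lemma subdiff_fin f x u : proper_fun f -> subdiff f x u -> f x \is a fin_num.
Proof.
move=> [fNy [z fz]] /(_ z) h; rewrite fin_numE fNy /=.
by apply: contraTneq (le_lt_trans h fz) => ->; rewrite addey.
Qed.

(** The subgradient inequality is equality in Fenchel-Young at (x, u): f^*(u) is
    <x, u> - f x, while f^*(v) is at least <x, v> - f x for every v. *)
Lemma subdiff_conjugate f x u :
  f x \is a fin_num -> subdiff f x u -> subdiff (conjugate f) u x.
Proof.
case Ef : (f x) => [a| |] // _ h v.
have le_u : (conjugate f u <= (inner x u - a)%:E)%E.
  apply/conjugate_leP => y; apply: le_trans (h y).
  by rewrite Ef -EFinD lee_fin linearBl; lra.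
have : ((inner x v)%:E - f x <= conjugate f v)%E.
  by apply: ereal_sup_ubound; exists x.
apply: le_trans; rewrite Ef -EFinB.
apply: le_trans (leeD2l _ le_u) _.
by rewrite -EFinD lee_fin (innerC (v - u)) linearBr; lra.
Qed.

(** The elementary inclusion of the sum rule: the two subgradient inequalities
    add up. *)
Lemma subdiffD f g x u v : subdiff f x u -> subdiff g x v ->
  subdiff (fun z => f z + g z)%E x (u + v).
Proof.
move=> hf hg y; rewrite linearDr EFinD addeACA.
exact: leeD (hf y) (hg y).
Qed.

(** Adding the two subgradient inequalities cancels the values of f and leaves
    <x - y, A x - A y> <= 0. *)
Lemma strongly_monotone_inclusion_inj f (A : H -> H) x y :
  proper_fun f -> (forall u v, inner (u - v) (A u - A v) <= 0 -> u = v) ->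
  subdiff f x (- A x) -> subdiff f y (- A y) -> x = y.
Proof.
move=> fp Amono sx sy; apply: Amono.
have := subdiff_fin _ _ _ fp sx; have := subdiff_fin _ _ _ fp sy.
have := sx y; have := sy x.
case: (f x) (f y) => [a| |] // [b| |] //; rewrite -!EFinD !lee_fin => hx hy _ _.
move: hx hy; rewrite !linearBl !linearBr !linearNr /=; lra.
Qed.

End subdifferential.

(** * The cyclic shift, the diagonal and the operator T *)

Section cyclic_shift.
Context {R : realType} {X : hilbertType R} {m : nat}.
Implicit Types (x y z v w : {ffun 'I_m -> X}).

Lemma ffun_innerE x y : inner x y = \sum_i inner (x i) (y i).
Proof. by []. Qed.

Lemma cycR_is_linear : linear (@cycR R X m).
Proof. by move=> a x y; apply/ffunP => i; rewrite !ffunE. Qed.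

HB.instance Definition _ := GRing.isLinear.Build R {ffun 'I_m -> X}
  {ffun 'I_m -> X} *:%R (@cycR R X m) cycR_is_linear.

Lemma inner_cycR x y : inner (cycR x) (cycR y) = inner x y.
Proof.
rewrite !ffun_innerE [RHS](reindex _ (onW_bij _ (ord_pred_bij m))) /=.
by apply: eq_bigr => i _; rewrite !ffunE.
Qed.

Lemma iter_cycRE k x i : iter k cycR x i = x (iter k (@ord_pred m) i).
Proof. by elim: k i => // k IH i; rewrite iterS ffunE IH -iterSr. Qed.

Lemma inner_iter_cycR k x y : inner (iter k cycR x) (iter k cycR y) = inner x y.
Proof. by elim: k => // k IH; rewrite !iterS inner_cycR. Qed.

(** The bound on k makes m - k a true difference, so that going k steps back
    is going m - k steps forward modulo m. *)
Lemma val_iter_ord_pred k (i : 'I_m) : (k <= m)%N ->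
  iter k (@ord_pred m) i = ((i + (m - k)) %% m)%N :> nat.
Proof.
elim: k => [_|k IH km]; first by rewrite subn0 modnDr modn_small.
rewrite iterS /= IH; last exact: ltnW.
have m0 : (0 < m)%N by apply: leq_trans km.
rewrite -subn1 -addnBA// modnDml -(subnSK km).
by rewrite addnS addSnnS subn1 prednK// modnDr.
Qed.

Lemma iter_cycR_id x : iter m cycR x = x.
Proof.
apply/ffunP => i; rewrite iter_cycRE; congr (x _).
by apply: val_inj; rewrite /= val_iter_ord_pred// subnn addn0 modn_small.
Qed.

Lemma cycR_Delta x : Delta x -> cycR x = x.
Proof. by case=> a _ <-; apply/ffunP => i; rewrite !ffunE. Qed.

Lemma Delta_cycR x : (0 < m)%N -> cycR x = x -> Delta x.
Proof.
move=> m0 Rx; exists (x (Ordinal m0)) => //.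
suff xconst n (nm : (n < m)%N) : x (Ordinal nm) = x (Ordinal m0).
  by apply/ffunP => -[n nm]; rewrite ffunE xconst.
elim: n nm => [|n IH] nm; first by congr (x _); exact: val_inj.
rewrite -(IH (ltnW nm)) -[in LHS]Rx ffunE; congr (x _).
by apply: val_inj; rewrite /= modnDr modn_small// ltnW.
Qed.

Lemma orth_DeltaP x : orth Delta x <-> \sum_i x i = 0.
Proof.
split=> [xD|x0 _ [a _ <-]].
  apply: inner_eq0; rewrite inner_sumr.
  rewrite -[RHS](xD _ (ex_intro2 _ _ (\sum_i x i) I erefl)) ffun_innerE.
  by apply: eq_bigr => i _; rewrite ffunE.
rewrite ffun_innerE (eq_bigr (fun i => inner a (x i))); last first.
  by move=> i _; rewrite ffunE.
by rewrite -inner_sumr x0 linear0r.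
Qed.

Lemma orth_Delta_cycR x : orth Delta x -> orth Delta (cycR x).
Proof.
move=> xD d dD; rewrite -(cycR_Delta d dD) inner_cycR; exact: xD.
Qed.

Lemma orth_Delta_iter_cycR k x : orth Delta x -> orth Delta (iter k cycR x).
Proof. by move=> xD; elim: k => //= k; exact: orth_Delta_cycR. Qed.

Lemma orth_Delta_subr_cycR x : orth Delta (cycR x - x).
Proof.
move=> d dD; apply/eqP; rewrite innerBr subr_eq0; apply/eqP.
by rewrite -[in LHS](cycR_Delta d dD) inner_cycR.
Qed.

(** The orbit sum is invariant under the shift, hence lies on the diagonal; it
    is also orthogonal to the diagonal, hence to itself. *)
Lemma sum_iter_cycR x : (0 < m)%N -> orth Delta x ->
  \sum_(0 <= k < m) iter k cycR x = 0.
Proof.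
move=> m0 xD; set s := \sum_(_ <= _ < _) _.
have sD : orth Delta s.
  move=> d dD; rewrite /s inner_sumr big1// => k _.
  exact: (orth_Delta_iter_cycR k x xD d dD).
apply: inner_eq0; apply: sD; apply: (Delta_cycR s m0).
apply/eqP; rewrite -subr_eq0 linear_sum -sumrB.
by rewrite (telescope_sumr (fun k => iter k cycR x))// iter_cycR_id subrr.
Qed.

(** The term Id / 2 is the missing k = 0 term of the sum that defines T. *)
Lemma half_opTE v : (0 < m)%N ->
  2^-1 *: v + opT v =
  (2 * m%:R : R)^-1 *:
    \sum_(0 <= k < m) (m%:R - 2 * k%:R : R) *: iter k cycR v.
Proof.
move=> m0; rewrite [in RHS]big_ltn// scalerDr scalerA; congr (_ *: _ + _).
by rewrite mulr0 subr0 invfM mulrVK// unitfE pnatr_eq0 -lt0n.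
Qed.

(** Id / 2 + T is the inverse of Id - R on the orthogonal complement of the
    diagonal. Summation by parts in k: the weights c k = m - 2 k have constant
    increment -2, so (c k) (R^(k+1) - R^k) telescopes up to 2 R^(k+1); the
    boundary terms give - 2 m x because R^m = Id and c m = - c 0 = - m, and the
    remaining orbit sum vanishes. *)
Lemma half_opT_subr_cycR x : (0 < m)%N -> orth Delta x ->
  2^-1 *: (cycR x - x) + opT (cycR x - x) = - x.
Proof.
move=> m0 xD; rewrite half_opTE//.
pose c k : R := m%:R - 2 * k%:R.
have step k : c k *: iter k cycR (cycR x - x) =
    (c k.+1 *: iter k.+1 cycR x - c k *: iter k cycR x)
    + 2 *: cycR (iter k cycR x).
  have -> : iter k cycR (cycR x - x) = iter k.+1 cycR x - iter k cycR x.
    by elim: k => //= k ->; rewrite linearB.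
  rewrite scalerBr addrAC -scalerDl; congr (_ *: _ - _).
  by rewrite /c -[k.+1]addn1 natrD; ring.
rewrite (eq_bigr _ (fun k _ => step k)).
rewrite big_split /= (telescope_sumr (fun k => c k *: iter k cycR x))//.
rewrite -scaler_sumr -linear_sum sum_iter_cycR// linear0 scaler0 addr0.
rewrite iter_cycR_id -scalerBl scalerA /c.
have mn0 : m%:R != 0 :> R by rewrite pnatr_eq0 -lt0n.
by rewrite -[RHS]scaleN1r; congr (_ *: _); field.
Qed.

Lemma opTB v w : opT v - opT w = opT (v - w).
Proof.
rewrite /opT -scalerBr -sumrB; congr (_ *: _); apply: eq_bigr => k _.
rewrite -scalerBr; congr (_ *: _).
by elim: k => //= k IH; rewrite -linearB IH.
Qed.

(** T is skew: <v, R^(m-k) v> = <R^k v, v> since R is an isometry with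
    R^m = Id, while the weight m - 2 k changes sign under k |-> m - k. *)
Lemma inner_opT v : inner v (opT v) = 0.
Proof.
pose c k : R := m%:R - 2 * k%:R; pose b k := inner v (iter k cycR v).
have -> : inner v (opT v) = (2 * m%:R)^-1 * \sum_(1 <= k < m) c k * b k.
  rewrite innerZr inner_sumr; congr (_ * _); apply: eq_bigr => k _.
  exact: innerZr.
suff -> : \sum_(1 <= k < m) c k * b k = 0 by rewrite mulr0.
suff h : \sum_(1 <= k < m) c k * b k = - \sum_(1 <= k < m) c k * b k by lra.
rewrite [LHS]big_nat_rev -sumrN; apply: eq_big_nat => k /andP[k0 km].
rewrite add1n subSS (_ : b (m - k)%N = b k); last first.
  rewrite /b -(inner_iter_cycR k v (iter (m - k) cycR v)) -iterD.
  by rewrite subnKC ?(ltnW km)// iter_cycR_id innerC.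
by rewrite /c natrB ?(ltnW km)//; ring.
Qed.

(** By skewness of T the left-hand side is half the squared norm of v - w. *)
Lemma half_opT_strongly_monotone v w :
  inner (v - w) (2^-1 *: v + opT v - (2^-1 *: w + opT w)) <= 0 -> v = w.
Proof.
rewrite opprD addrACA -scalerBr opTB innerDr inner_opT innerZr /= addr0.
rewrite innerE pmulr_rle0 ?invr_gt0// => h; apply/subr0_eq/eqP.
by rewrite -normr_eq0 -sqrf_eq0 eq_le h sqr_ge0.
Qed.

End cyclic_shift.

(** * Separable sums and indicators *)

Section sums_of_functions.
Context {R : realType} {X : hilbertType R} {m : nat}.
Implicit Types (f : 'I_m -> X -> \bar R).

Lemma sep_sum_proper f : (forall i, proper_fun (f i)) -> proper_fun (sep_sum f).
Proof.
move=> f_proper; split=> [z|].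
  rewrite /sep_sum; elim/big_ind : _ => // [a b|i _].
    by case: a b => [a| |] // [b| |].
  by have [fNy _] := f_proper i.
have /choice[a af] i : exists a, dom (f i) a.
  by have [_ [a fa]] := f_proper i; exists a.
exists [ffun i => a i]; rewrite /dom /sep_sum /=.
elim/big_ind : _ => // [u v|i _]; first exact: lte_add_pinfty.
by rewrite ffunE; exact: af.
Qed.

(** Varying the single coordinate i leaves the other summands unchanged, and
    they can be cancelled because they are finite wherever a subgradient
    exists. *)
Lemma subdiff_sep_sum f z w :
  proper_fun (sep_sum f) -> subdiff (sep_sum f) z w ->
  forall i, subdiff (f i) (z i) (w i).
Proof.
move=> fp sw i a.
have := subdiff_fin _ _ _ fp sw.
have := sw [ffun j => if j == i then a else z j].
rewrite /sep_sum (bigD1 i)//= [in X in (_ <= X -> _)%E](bigD1 i)//=.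
rewrite ffunE eqxx fin_numD => h /andP[_ rest_fin]; move: h.
rewrite [in X in (_ <= X -> _)%E](eq_bigr (fun j => f j (z j))); last first.
  by move=> j /negPf ji; rewrite ffunE ji.
rewrite addeA leeD2rE// ffun_innerE (bigD1 i)//= big1 ?addr0; last first.
  by move=> j /negPf ji; rewrite !ffunE ji subrr linear0l.
by rewrite !ffunE eqxx.
Qed.

End sums_of_functions.

Lemma indicator_proper (R : realType) (H : hilbertType R) (C : set H) :
  C !=set0 -> proper_fun (indicator C).
Proof.
case=> c Cc; split=> [x|]; first by rewrite /indicator; case: ifP.
by exists c; rewrite /dom /indicator /= mem_set.
Qed.

(** A vector orthogonal to C - x is normal to C at x; for a linear subspace,
    such as the diagonal, all normals are of this kind. *)
Lemma subdiff_indicator (R : realType) (H : hilbertType R) (C : set H) x u :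
  C x -> (forall y, C y -> inner (y - x) u = 0) -> subdiff (indicator C) x u.
Proof.
move=> Cx u0 y; rewrite /indicator mem_set// adde0.
by case: ifPn => [/set_mem/u0->//|_]; exact: leey.
Qed.

(** * From primal solutions and cycles to the dual inclusion *)

Section duality.
Context {R : realType} {X : hilbertType R} {m : nat}.
Implicit Types (f : 'I_m -> X -> \bar R) (x y z w : {ffun 'I_m -> X}).

(** The shift d is minus the average of the coordinates of z. *)
Lemma Delta_orth_shift z : (0 < m)%N -> exists2 d, Delta d & orth Delta (z + d).
Proof.
move=> m0; exists [ffun=> - (m%:R^-1 *: \sum_i z i)]; first by eexists.
apply/orth_DeltaP; under eq_bigr do rewrite !ffunE.
rewrite big_split /= sumr_const card_ord -scaler_nat scalerN scalerA.
by rewrite mulfV ?scale1r ?subrr// pnatr_eq0 -lt0n.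
Qed.

Definition conjugate_sum f v : \bar R :=
  (conjugate (sep_sum f) v + conjugate (indicator Delta) v)%E.

Lemma dual_solE f y : dual_sol f y <->
  subdiff (conjugate_sum f) y (- (2^-1 *: y + opT y)).
Proof.
split=> [[u su /eqP]|sy]; first by rewrite -addrA addr_eq0 => /eqP <-.
by eexists; [exact: sy|rewrite -addrA addNr].
Qed.

Lemma Delta_neq0 : @Delta R X m !=set0.
Proof. by exists [ffun=> 0]; exists 0. Qed.

(** On vectors orthogonal to the diagonal the conjugate of the indicator is at
    most 0, so the qualification condition provides a point of finiteness. *)
Lemma conjugate_sum_proper f :
  proper_fun (sep_sum f) ->
  dom (conjugate (sep_sum f)) `&` orth Delta !=set0 ->
  proper_fun (conjugate_sum f).
Proof.
move=> fp [v [fv vD]]; have [iNy idom] := indicator_proper _ _ _ Delta_neq0.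
split=> [u|].
  rewrite adde_eq_ninfty negb_or conjugate_gtNy ?conjugate_gtNy//.
  by have [] := fp.
exists v; rewrite /dom /=; apply: lte_add_pinfty => //.
apply: (@le_lt_trans _ _ 0%:E) (ltry _); apply/conjugate_leP => x.
rewrite /indicator; case: ifPn => [/set_mem xD|_]; last exact: leey.
by rewrite (vD x xD) subr0.
Qed.

Lemma dual_sol_unique f y y' : proper_fun (conjugate_sum f) ->
  dual_sol f y -> dual_sol f y' -> y = y'.
Proof.
move=> pp /dual_solE sy /dual_solE sy'.
apply: (strongly_monotone_inclusion_inj _ (fun v => 2^-1 *: v + opT v))
  sy sy' => //.
exact: half_opT_strongly_monotone.
Qed.

(** For x orthogonal to the diagonal, - (Id / 2 + T) (R x - x) is x itself, so
    the dual inclusion at R x - x only asks that x be a subgradient there. *)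
Lemma dual_sol_of_subdiff f x : (0 < m)%N -> orth Delta x ->
  subdiff (conjugate_sum f) (cycR x - x) x -> dual_sol f (cycR x - x).
Proof.
by move=> m0 xD sx; apply/dual_solE; rewrite half_opT_subr_cycR// opprK.
Qed.

(** The function of the dual inclusion is the conjugate of the one of the
    primal inclusion, so the primal inclusion can be inverted by
    Fenchel-Young. *)
Lemma primal_sol_dual_sol f x : (0 < m)%N -> proper_fun (sep_sum f) ->
  dom (conjugate (sep_sum f)) `&` orth Delta !=set0 ->
  primal_sol f x -> dual_sol f (cycR x - x).
Proof.
move=> m0 fp fD [[u su /eqP]]; rewrite addr_eq0 opprB => /eqP uE xD.
move: su; rewrite uE => su {u uE}; apply: dual_sol_of_subdiff => //.
have ip := indicator_proper _ _ _ Delta_neq0.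
have [_ [v0 cv0]] := conjugate_sum_proper f fp fD.
have gE : conjugate_sum f =
    conjugate (lsc_hull (inf_convolution (sep_sum f) (indicator Delta))).
  by rewrite conjugate_lsc_hull conjugate_inf_convolution.
rewrite gE in cv0 *.
apply: subdiff_conjugate (su); apply: subdiff_fin su; split=> [z|].
  by apply: gtNy_of_conjugate; exists v0.
have [_ [a fa]] := fp; have [_ [b ib]] := ip.
exists (a + b); apply: le_lt_trans (lsc_hull_le _ _) _.
apply: le_lt_trans (lte_add_pinfty fa ib).
by apply: ereal_inf_lbound; exists a => //; rewrite (addrC a) addrK.
Qed.

Lemma cyclesE f z : cycles f z <-> subdiff (sep_sum f) z (cycR z - z).
Proof.
split=> [[u su /eqP]|sz]; last by eexists; [exact: sz|rewrite subrK subrr].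
by rewrite -addrA addr_eq0 opprB => /eqP <-.
Qed.

(** Translating z along the diagonal to a point z + d of the orthogonal
    complement does not change the gap vector R z - z. There z is a subgradient
    of the conjugate of the sum, d is one of the conjugate of the indicator,
    and they add up to z + d. *)
Lemma cycles_dual_sol f z : (0 < m)%N -> proper_fun (sep_sum f) ->
  cycles f z -> dual_sol f (cycR z - z).
Proof.
move=> m0 fp /cyclesE sz; have [d dD zdD] := Delta_orth_shift z m0.
have E : cycR (z + d) - (z + d) = cycR z - z.
  by rewrite linearD /= (cycR_Delta d dD) opprD addrACA subrr addr0.
rewrite -E; apply: dual_sol_of_subdiff => //; rewrite E.
apply: subdiffD.
  by apply: subdiff_conjugate (sz); apply: subdiff_fin sz.
have sd : subdiff (indicator Delta) d (cycR z - z).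
  apply: subdiff_indicator => // y yD.
  by rewrite innerBl !orth_Delta_subr_cycR// subrr.
apply: subdiff_conjugate (sd); apply: subdiff_fin sd.
exact: indicator_proper Delta_neq0.
Qed.

End duality.

(** * Cycles and compositions of proximity operators *)

Section prox_cycles.
Context {R : realType} {X : hilbertType R} {m : nat}.
Implicit Types (f : 'I_m -> X -> \bar R) (z : {ffun 'I_m -> X}).

Lemma cycles_Prox f z i : proper_fun (sep_sum f) -> cycles f z ->
  Prox (f i) (z (ord_pred i)) (z i).
Proof.
move=> fp /cyclesE /(subdiff_sep_sum _ _ _ fp)/(_ i); rewrite !ffunE => si.
by exists (z (ord_pred i) - z i) => //; rewrite addrC subrK.
Qed.

(** The coordinates of z along a path of successive indices form a trajectory
    of the composed operators; A is the composition accumulated so far. *)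
Lemma foldl_comp_op f z (A : X -> set X) a i s :
  (forall j, Prox (f j) (z (ord_pred j)) (z j)) ->
  A a (z i) -> path (fun j k => j == ord_pred k) i s ->
  foldl (fun A j => comp_op (Prox (f j)) A) A s a (z (last i s)).
Proof.
move=> zP; elim: s A i => //= j s IH A i Az /andP[/eqP ij]; apply: IH.
by exists (z i) => //; rewrite ij.
Qed.

Lemma cycle_enum_ord : cycle (fun j k : 'I_m => j == ord_pred k) (enum 'I_m).
Proof.
pose e a b := (a == (b + m).-1 %% m)%N.
have -> : cycle (fun j k : 'I_m => j == ord_pred k) (enum 'I_m) =
    cycle e (iota 0 m).
  by rewrite -val_enum_ord [RHS]cycle_map; apply: eq_cycle => j k.
(* The last index n precedes 0 because (0 + n.+1).-1 = n. *)
case: m @e => [//|n] e.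
have path_iota k l : (k + l < n.+1)%N -> path e k (iota k.+1 l).
  elim: l k => //= l IH k kl; rewrite IH ?addSnnS// andbT /e /=.
  by rewrite modnDr modn_small//; apply: leq_ltn_trans kl; rewrite leq_addr.
rewrite /= rcons_path path_iota//=.
have -> : last 0%N (iota 1 n) = n.
  by case: n {e path_iota} => // n; rewrite -{1}(addn1 n) iotaD last_cat.
by rewrite /e /= modn_small.
Qed.

(** The enumeration of the indices is a cycle for the successor relation; the
    rotation i.+1 starts right after i and ends at i. *)
Lemma path_rot_enum_ord (i : 'I_m) :
  path (fun j k => j == ord_pred k) i (rot i.+1 (enum 'I_m)) /\
  last i (rot i.+1 (enum 'I_m)) = i.
Proof.
have im : (i < size (enum 'I_m))%N by rewrite size_enum_ord.
have := cycle_enum_ord; rewrite -(rot_cycle i) rotS//.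
rewrite /(rot i _) (drop_nth i im) nth_ord_enum /= rot1_cons => ->.
by rewrite last_rcons.
Qed.

Lemma cycles_Fix_prox_cycle f z i : proper_fun (sep_sum f) -> cycles f z ->
  Fix (prox_cycle f i) (z i).
Proof.
move=> fp zZ; have [ip il] := path_rot_enum_ord i.
have := foldl_comp_op f z (fun a => [set a]) (z i) i _
  (fun j => cycles_Prox f z j fp zZ) erefl ip.
by rewrite il.
Qed.

End prox_cycles.

(** * Characterization of the classical cycles *)

Theorem corollary4p5 (R : realType) (X : hilbertType R) (m : nat)
    (hm : (0 < m)%N) (f : 'I_m -> X -> \bar R)
    (f_proper : forall i, proper_fun (f i))
    (f_lsc : forall i, lower_semicontinuous (f i))
    (f_convex : forall i, convex_fun (f i))
    (f_dom : dom (conjugate (sep_sum f)) `&` orth Delta !=set0)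
    (x y : {ffun 'I_m -> X})
    (hx : primal_sol f x) (hy : dual_sol f y) :
  [/\ orth Delta x /\ orth Delta y,
      y = cycR x - x,
      x = - (2^-1 *: y) - opT y,
      cycles f = [set x + d | d in Delta]
                   `&` inv_op (subdiff (sep_sum f)) (cycR x - x) /\
      [set x + d | d in Delta] `&` inv_op (subdiff (sep_sum f)) (cycR x - x)
        = inv_op IdR (- y) `&` inv_op (subdiff (sep_sum f)) y
    & 
      cycles f `<=` [set z : {ffun 'I_m -> X} |
                       forall i, Fix (prox_cycle f i) (z i)]
                    `&` inv_op IdR (- y)].
Proof.
have fp := sep_sum_proper f f_proper.
have dual_inj := dual_sol_unique f _ _ (conjugate_sum_proper f fp f_dom).
have [_ xD] := hx.
have yE : y = cycR x - x.
  exact: dual_inj hy (primal_sol_dual_sol f x hm fp f_dom hx).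
have cycle_gap z : cycles f z -> cycR z - z = cycR x - x.
  by move=> zZ; rewrite -yE; apply: dual_inj hy; exact: cycles_dual_sol.
have shiftP z : [set x + d | d in Delta] z <-> cycR z - z = cycR x - x.
  split=> [[d dD <-]|zx].
    by rewrite linearD /= (cycR_Delta d dD) opprD addrACA subrr addr0.
  exists (z - x); last by rewrite addrC subrK.
  apply: Delta_cycR => //; rewrite linearB /=.
  have -> : cycR z = cycR x - x + z by rewrite -zx subrK.
  by rewrite addrAC (addrAC (cycR x)) subrr add0r addrC.
have inv_IdRP z : inv_op IdR (- y) z <-> cycR z - z = cycR x - x.
  rewrite /inv_op /IdR /= yE -[z - _]opprB.
  by split=> [/oppr_inj|] ->.
split=> //.
- by split=> //; rewrite yE; exact: orth_Delta_subr_cycR.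
- by rewrite -opprD yE half_opT_subr_cycR// opprK.
- split; apply/seteqP; split=> z.
  + move=> zZ; split; first by apply/shiftP/cycle_gap.
    by rewrite /inv_op /= -(cycle_gap z zZ); apply/cyclesE.
  + by case=> /shiftP zx sz; apply/cyclesE; rewrite zx.
  + by case=> /shiftP zx sz; split; [exact/inv_IdRP|rewrite yE].
  + by case=> /inv_IdRP zx; rewrite yE => sz; split; [exact/shiftP|].
- move=> z zZ; split; last exact/inv_IdRP/cycle_gap.
  by move=> i; exact: cycles_Fix_prox_cycle.
Qed.
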